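(* Let $L$ be the three-dimensional abelian Lie algebra over the finite field $\mathbb{F}_q$, let $\mathcal{L}$ be the set of its one-dimensional subalgebras (lines) and $\mathcal{P}$ the set of its two-dimensional subalgebras (planes). The comaximal graph $\Gamma(L)$ has vertex set $\mathcal{V}=\mathcal{L}\sqcup\mathcal{P}$, and adjacency is described as follows: (1) If $A,B\in\mathcal{P}$ with $A\neq B$, then they are adjacent. Thus the induced subgraph on $\mathcal{P}$ is the complete graph $K_{q^2+q+1}$. (2) If $A,B\in\mathcal{L}$, then they are never adjacent. Thus $\mathcal{L}$ is an independent set. (3) For $A\in\mathcal{L}$ and $B\in\mathcal{P}$ one has $A\sim B$ if and only if $A\not\subseteq B$. In particular, $\deg(B)=2q^2+q$ for every $B\in\mathcal{P}$ and $\deg(A)=q^2$ for every $A\in\mathcal{L}$.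
   Context: The comaximal graph $\Gamma(L)$ of a finite-dimensional Lie algebra $L$ is the simple undirected graph whose vertices are the nonzero proper Lie subalgebras of $L$, two distinct vertices $A,B$ being adjacent (written $A\sim B$) if and only if $\langle A,B\rangle=L$, where $\langle A,B\rangle$ denotes the Lie subalgebra generated by $A\cup B$. *)

(* Defs.v *)
From HB Require Import structures.
From mathcomp Require Import all_boot all_algebra.
From mathcomp Require Import boolp classical_sets functions cardinality.

Set Implicit Arguments.
Unset Strict Implicit.
Unset Printing Implicit Defensive.

Import GRing.Theory.
Local Open Scope classical_set_scope.
Local Open Scope card_scope.
Local Open Scope ring_scope.

(* Finite-dimensional Lie algebras: finite-dimensionality comes from vectType. *)
HB.mixin Record Vector_isLieAlgebra (F : fieldType) L of Vector F L := {
  lie_bracket : L -> L -> L;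
  lie_bracketDZl : forall (a : F) (x y z : L),
    lie_bracket (a *: x + y) z = a *: lie_bracket x z + lie_bracket y z;
  lie_bracketDZr : forall (a : F) (x y z : L),
    lie_bracket z (a *: x + y) = a *: lie_bracket z x + lie_bracket z y;
  lie_bracketxx : forall x : L, lie_bracket x x = 0;
  lie_jacobi : forall x y z : L,
    lie_bracket x (lie_bracket y z) + lie_bracket y (lie_bracket z x)
      + lie_bracket z (lie_bracket x y) = 0
}.

#[short(type="lieAlgType")]
HB.structure Definition LieAlgebra (F : fieldType) :=
  { L of Vector_isLieAlgebra F L & Vector F L }.

Definition lie_abelian (F : fieldType) (L : lieAlgType F) : Prop :=
  forall x y : L, lie_bracket x y = 0.

Definition lie_subalgebra (F : fieldType) (L : lieAlgType F)
    (U : {vspace L}) : Prop :=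
  forall x y : L, x \in U -> y \in U -> lie_bracket x y \in U.

Definition lie_generated (F : fieldType) (L : lieAlgType F)
    (X : set L) : set L :=
  \bigcap_(U in [set U : {vspace L} | lie_subalgebra U /\ X `<=` [set` U]])
    [set` U].

(* Simple undirected graphs with vertices in an ambient type T; edges only
   join elements of the vertex set. *)
Record sgraph (T : Type) := SGraph {
  vertices : set T;
  adj : T -> T -> Prop;
  adj_sym : forall x y, adj x y -> adj y x;
  adj_irrefl : forall x, ~ adj x x;
  adj_vertices : forall x y, adj x y -> vertices x
}.

Section GraphNotions.
Variable T : Type.
Implicit Types (G : sgraph T) (S : set T).

Definition neighbours G (x : T) : set T := [set y | adj G x y].

Definition has_degree G (x : T) (d : nat) : Prop := neighbours G x #= `I_d.

Definition independent G S : Prop :=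
  S `<=` vertices G /\ forall x y, S x -> S y -> ~ adj G x y.

Definition induced_adj G S (x y : T) : Prop := [/\ S x, S y & adj G x y].

Fact induced_adj_sym G S x y : induced_adj G S x y -> induced_adj G S y x.
Proof. by case=> Sx Sy xy; split=> //; apply: adj_sym. Qed.

Fact induced_adj_irrefl G S x : ~ induced_adj G S x x.
Proof. by case=> _ _; apply: adj_irrefl. Qed.

Fact induced_adj_vertices G S x y :
  induced_adj G S x y -> (vertices G `&` S) x.
Proof. by case=> Sx _ xy; split=> //; exact: adj_vertices xy. Qed.

Definition induced_subgraph G S : sgraph T :=
  SGraph (@induced_adj_sym G S) (@induced_adj_irrefl G S)
    (@induced_adj_vertices G S).

End GraphNotions.

Section CompleteGraph.
Variable n : nat.

Definition complete_adj (i j : 'I_n) : Prop := i <> j.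

Fact complete_adj_sym i j : complete_adj i j -> complete_adj j i.
Proof. by move=> + /esym. Qed.

Fact complete_adj_irrefl i : ~ complete_adj i i.
Proof. by apply. Qed.

Fact complete_adj_vertices i j : complete_adj i j -> [set: 'I_n] i.
Proof. by []. Qed.

Definition complete_graph : sgraph 'I_n :=
  SGraph complete_adj_sym complete_adj_irrefl complete_adj_vertices.

End CompleteGraph.

Definition graph_iso (T T' : Type) (G : sgraph T) (H : sgraph T') : Prop :=
  exists f : T -> T', set_bij (vertices G) (vertices H) f /\
    forall x y, vertices G x -> vertices G y ->
      (adj G x y <-> adj H (f x) (f y)).

Section ComaximalGraph.
Variables (F : fieldType) (L : lieAlgType F).
Implicit Types A B : {vspace L}.

Definition comax_vertices : set {vspace L} :=
  [set A | [/\ lie_subalgebra A, A <> 0%VS & A <> fullv]].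

Definition comax_adj A B : Prop :=
  [/\ comax_vertices A, comax_vertices B, A <> B &
      lie_generated ([set` A] `|` [set` B]) = [set: L]].

Fact comax_adj_sym A B : comax_adj A B -> comax_adj B A.
Proof. by case=> VA VB AB gen; split=> //; [move/esym | rewrite setUC]. Qed.

Fact comax_adj_irrefl A : ~ comax_adj A A.
Proof. by case. Qed.

Fact comax_adj_vertices A B : comax_adj A B -> comax_vertices A.
Proof. by case. Qed.

Definition comaximal_graph : sgraph {vspace L} :=
  SGraph comax_adj_sym comax_adj_irrefl comax_adj_vertices.

Definition lie_lines : set {vspace L} :=
  [set A | lie_subalgebra A /\ \dim A = 1%N].

Definition lie_planes : set {vspace L} :=
  [set A | lie_subalgebra A /\ \dim A = 2%N].

End ComaximalGraph.

Arguments comaximal_graph {F} L.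
Arguments lie_lines {F} L.
Arguments lie_planes {F} L.

(* Main.v *)
(* In an abelian Lie algebra every subspace is a subalgebra and <A, B> = A +
   B, so in dimension three everything but the counting is the dimension
   formula.
   All the counts come from one: the complements in W of a subspace U are
   the graphs of the linear maps from a fixed complement V of U to U, hence
   there are q ^ (dim V * dim U) of them. A line A has q ^ 2 complementary
   planes, which are its neighbours; a plane has q ^ 2 complementary lines;
   a plane contains a fixed line and its q complements, that is q + 1 lines;
   intersecting with a fixed plane complementary to A shows that A lies on q
   + 1 planes, whence q ^ 2 + q + 1 planes in all. *)
Require Import Defs.
From HB Require Import structures.
From mathcomp Require Import all_boot all_algebra finfield.
From mathcomp Require Import boolp classical_sets functions cardinality.
From mathcomp Require Import zify.

Set Implicit Arguments.
Unset Strict Implicit.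
Unset Printing Implicit Defensive.

Import GRing.Theory.
Local Open Scope ring_scope.

(** * Finiteness of the set of subspaces *)

Section FiniteSubspaces.
Variables (F : finFieldType) (vT : vectType F).

(** A subspace is determined by its canonical matrix [vs2mx], and over a finite field there are
    finitely many matrices. *)
HB.instance Definition _ := isCountable.Build {vspace vT}
  (pcan_pickleK (can_pcan (@VectorInternalTheory.vs2mxK F vT))).
HB.instance Definition _ := isFinite.Build {vspace vT}
  (pcan_enumP (can_pcan (@VectorInternalTheory.vs2mxK F vT))).

End FiniteSubspaces.

(** * Complements of a subspace and their number *)

Section Complements.
Variables (F : finFieldType) (vT : vectType F).
Implicit Types U V W X : {vspace vT}.

(** Once [X + U = W], additivity of dimensions encodes that [X] and [U] meet trivially. *)
Definition complements W U : {set {vspace vT}} :=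
  [set X | (X + U == W)%VS && (\dim X + \dim U == \dim W)%N].

Lemma complements_capv W U X : X \in complements W U -> (X :&: U = 0)%VS.
Proof.
rewrite inE => /andP[/eqP defW /eqP dimW]; apply/eqP.
by move: (dimv_sum_cap X U); rewrite defW -dimW -dimv_eq0; lia.
Qed.

Definition lfun_graph U V (f : 'Hom(subvs_of V, subvs_of U)) : {vspace vT} :=
  limg (linfun vsval + (linfun vsval \o f))%VF.

Lemma mem_lfun_graph U V (f : 'Hom(subvs_of V, subvs_of U)) x :
  reflect (exists v, x = vsval v + vsval (f v)) (x \in lfun_graph f).
Proof.
apply: (iffP memv_imgP) => [[v _ ->]|[v ->]]; exists v; rewrite ?memvf //.
  by rewrite add_lfunE comp_lfunE !lfunE.
by rewrite add_lfunE comp_lfunE !lfunE.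
Qed.

(** The vector [v - v' = u' - u] lies in both [V] and [U], hence vanishes. *)
Lemma capv0_add_inj U V (u u' v v' : vT) : (V :&: U = 0)%VS ->
  u \in U -> u' \in U -> v \in V -> v' \in V -> v + u = v' + u' ->
  v = v' /\ u = u'.
Proof.
move=> VU0 uU u'U vV v'V e.
have e' : v - v' = u' - u.
  by rewrite -[v](addrK u) e addrAC (addrC v') addrK.
have: v - v' \in (V :&: U)%VS by rewrite memv_cap {2}e' !rpredB.
rewrite VU0 memv0 => /eqP e0; move: e'; rewrite e0 => /esym/eqP.
rewrite subr_eq0 => /eqP ->; split=> //.
by apply/eqP; rewrite -subr_eq0 e0.
Qed.

(** The map [v |-> v + f v] is injective: [v + f v = 0] decomposes zero in a direct sum, so
    [v = 0]. *)
Lemma dim_lfun_graph U V (f : 'Hom(subvs_of V, subvs_of U)) :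
  (V :&: U = 0)%VS -> \dim (lfun_graph f) = \dim V.
Proof.
move=> VU0; rewrite limg_dim_eq; first by rewrite dimvf.
apply/eqP; rewrite -subv0; apply/subvP => v /memv_capP[_].
rewrite memv_ker add_lfunE comp_lfunE !lfunE /= => /eqP e.
have [v0 _] := capv0_add_inj VU0 (subvsP (f v)) (mem0v U) (subvsP v) (mem0v V)
  (etrans e (esym (addr0 0))).
by rewrite memv0; apply/eqP/val_inj.
Qed.

Lemma lfun_graph_inj U V : (V :&: U = 0)%VS -> injective (@lfun_graph U V).
Proof.
move=> VU0 f g efg; apply/lfunP => v.
have: vsval v + vsval (f v) \in lfun_graph f by apply/mem_lfun_graph; exists v.
rewrite efg => /mem_lfun_graph[w e].
have [vw fg] := capv0_add_inj VU0 (subvsP _) (subvsP _) (subvsP _) (subvsP _) e.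
by apply: val_inj; rewrite /= fg (val_inj vw).
Qed.

(** Each equality of subspaces needed here comes from one containment and equal dimensions.
    [finvect_type] makes the space of linear maps a finite type, so that its image is a finite
    set. *)
Lemma complements_lfun_graph U V W :
  V \in complements W U -> 
  complements W U =
    [set lfun_graph (f : 'Hom(subvs_of V, subvs_of U))
      | f : finvect_type 'Hom(subvs_of V, subvs_of U)].
Proof.
move=> VWU; have VU0 := complements_capv VWU.
have /andP[/eqP defW /eqP dimW] : (V + U == W)%VS && (\dim V + \dim U == \dim W)%N.
  by rewrite inE in VWU.
apply/setP => X; apply/idP/imsetP => [XWU | [f _ ->]].
  have XU0 := complements_capv XWU.
  have /andP[/eqP defX /eqP dimX] : (X + U == W)%VS && (\dim X + \dim U == \dim W)%N.
    by rewrite inE in XWU.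
  (* v |-> u with v + u in X, i.e. minus the projection to U along X *)
  exists (linfun (vsproj U) \o - daddv_pi U X \o linfun vsval)%VF => //.
  apply/esym/eqP; rewrite eqEdim dim_lfun_graph //.
  apply/andP; split; last by lia.
  apply/subvP => _ /mem_lfun_graph[v ->].
  rewrite !comp_lfunE !lfunE /= vsprojK ?memvN ?memv_pi //.
  have UX0 : (U :&: X = 0)%VS by rewrite capvC.
  (* Subtracting from [v] its projection to [U] leaves its projection to [X], which lies in [X]. *)
  rewrite -[X in X - _](daddv_pi_add UX0); last first.
    by rewrite addvC defX -defW (subvP (addvSl V U)) ?subvsP.
  by rewrite addrAC subrr add0r memv_pi.
rewrite inE dim_lfun_graph // dimW eqxx andbT eqEdim; apply/andP; split.
  rewrite -defW subv_add addvSr andbT; apply/subvP => _ /mem_lfun_graph[v ->].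
  by rewrite memv_add ?subvsP.
rewrite -dimW -(dim_lfun_graph f VU0) -dimv_disjoint_sum //.
apply/eqP; rewrite -subv0; apply/subvP => u /memv_capP[/mem_lfun_graph[v e] uU].
rewrite memv0 e; move: uU; rewrite e => uU.
(* [v] is the difference of [v + f v] and [f v], both in [U]. *)
have : vsval v \in (V :&: U)%VS.
  rewrite memv_cap subvsP -[vsval v](addrK (vsval (f v))).
  by rewrite memvB ?subvsP.
rewrite VU0 memv0 => /eqP v0; have -> : v = 0 by apply: val_inj.
by rewrite !linear0 addr0.
Qed.

Lemma diffv_complements U W : (U <= W)%VS -> (W :\: U)%VS \in complements W U.
Proof.
move=> UW; rewrite inE addv_diff (addv_idPl UW) eqxx.
rewrite -(dimv_disjoint_sum (capv_diff W U)) addv_diff.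
by rewrite (addv_idPl UW) eqxx.
Qed.

Lemma card_complements U W : (U <= W)%VS ->
  #|complements W U| = (#|F| ^ ((\dim W - \dim U) * \dim U))%N.
Proof.
move=> UW; have VWU := diffv_complements UW.
rewrite (complements_lfun_graph VWU) card_imset; last first.
  exact: lfun_graph_inj (complements_capv VWU).
pose H := finvect_type 'Hom(subvs_of (W :\: U)%VS, subvs_of U).
rewrite -[#|_|]/#|H| -(@card_vspacef F H (Vector.class _)) card_vspace dimvf.
move: VWU; rewrite inE => /andP[_ /eqP dimW].
by have -> : (\dim W - \dim U = \dim (W :\: U)%VS)%N by lia.
Qed.
End Complements.

(** * Counting lines and planes *)

Section DimensionCounts.
Variables (F : finFieldType) (vT : vectType F).
Implicit Types A B C U V W X : {vspace vT}.

Definition subspaces k W : {set {vspace vT}} :=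
  [set X | (X <= W)%VS && (\dim X == k)].

(** The intersection of [X] with a line [A] is either zero or all of [A], so meeting [A] trivially
    amounts to not containing it. *)
Lemma complements_line A W X : \dim A = 1%N -> (A <= W)%VS ->
  (X \in complements W A) =
  [&& (X <= W)%VS, (\dim X).+1 == \dim W & ~~ (A <= X)%VS].
Proof.
move=> dimA AW; apply/idP/and3P => [XWA | [XW /eqP dimX AX]].
  have cap0 := complements_capv XWA.
  move: XWA; rewrite inE => /andP[/eqP <- /eqP dimX].
  rewrite addvSl -dimX dimA addn1 eqxx; split=> //.
  apply/negP => /capv_idPr XA; move: dimA.
  by rewrite -XA cap0 dimv0.
rewrite inE dimA addn1 dimX eqxx andbT eqEdim subv_add XW AW /=.
rewrite dimv_disjoint_sum ?dimA ?addn1 ?dimX //.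
apply/eqP; rewrite -dimv_eq0 -leqn0 -ltnS -dimA ltnNge.
apply: contra AX => dimcap; apply/capv_idPr/eqP.
by rewrite eqEdim capvSr.
Qed.

Lemma card_lines_of_plane C : \dim C = 2%N -> #|subspaces 1 C| = (#|F| + 1)%N.
Proof.
(* [vpick C] is a nonzero vector because [C] is nonzero, so it spans a line. *)
move=> dimC; pose D := <[vpick C]>%VS.
have dimD : \dim D = 1%N by rewrite dim_vline vpick0 -dimv_eq0 dimC.
have DC : (D <= C)%VS by rewrite -memvE memv_pick.
have -> : subspaces 1 C = D |: complements C D.
  apply/setP => X; rewrite in_setU1 complements_line // dimC eqSS !inE.
  case: (eqVneq X D) => [->|XD] /=; first by rewrite DC dimD.
  case XC: (X <= C)%VS => //=; case: eqP => //= dimX; apply/esym.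
  by apply: contra XD => DX; rewrite eq_sym eqEdim DX dimX dimD.
rewrite cardsU1 complements_line // subvv !andbF card_complements //.
by rewrite dimC dimD expn1 addnC.
Qed.

Hypothesis dim3 : \dim {:vT} = 3%N.

(** By the modular law, [D |-> D + A] and [X |-> X :&: C] are mutually inverse between the lines of
    a complement [C] and the planes through [A]. *)
Lemma card_planes_through A : \dim A = 1%N ->
  #|[set X : {vspace vT} | (A <= X)%VS && (\dim X == 2%N)]| = (#|F| + 1)%N.
Proof.
move=> dimA; pose C := ({:vT} :\: A)%VS.
have CA0 : (C :&: A = 0)%VS := capv_diff _ _.
have dimC : \dim C = 2%N.
  by move: (dimv_cap_compl {:vT} A); rewrite capfv dimA dim3; case.
have modC D : (D <= C)%VS -> ((D + A) :&: C = D)%VS.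
  by move=> DC; rewrite -vspace_modl // capvC CA0 addv0.
rewrite -(card_lines_of_plane dimC).
have inj : {in subspaces 1 C &, injective (addv^~ A)}.
  move=> D D'; rewrite !inE => /andP[DC _] /andP[D'C _] /= e.
  by rewrite -(modC D) // e modC.
rewrite -(card_in_imset inj); apply/eq_card => X; rewrite inE.
apply/andP/imsetP => [[AX /eqP dimX]|[D + ->]].
  have e : X = (X :&: C + A)%VS.
    by rewrite vspace_modr // /C addv_diff (addv_idPl (subvf A)) capvf.
  exists (X :&: C)%VS => //; rewrite inE capvSr /=.
  (* [X :&: C] meets [A] trivially and their sum is the plane [X], so [X :&: C] has dimension 2 -
     1. *)
  have := dimv_sum_cap (X :&: C) A.
  rewrite -e -capvA CA0 capv0 dimv0 dimX dimA addn0 addn1.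
  by case=> <-.
rewrite inE => /andP[DC /eqP dimD]; rewrite addvSr dimv_disjoint_sum ?dimD ?dimA //.
by apply/eqP; rewrite -subv0 -CA0 capvS.
Qed.

(** Planes split according to whether they contain a fixed line; those that do not are exactly its
    complements. *)
Lemma card_planes : #|subspaces 2 {:vT}| = (#|F| ^ 2 + #|F| + 1)%N.
Proof.
pose A := <[vpick {:vT}]>%VS.
have dimA : \dim A = 1%N by rewrite dim_vline vpick0 -dimv_eq0 dim3.
have -> : subspaces 2 {:vT} = complements fullv A :|:
    [set X : {vspace vT} | (A <= X)%VS && (\dim X == 2%N)].
  apply/setP => X; rewrite finset.in_setU complements_line ?subvf // dim3 eqSS !inE.
  by rewrite subvf /=; case: (\dim X == _); case: (A <= X)%VS.
rewrite cardsU card_planes_through // card_complements ?subvf // dim3 dimA muln1.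
rewrite (_ : _ :&: _ = finset.set0) ?cards0 ?subn0 ?addnA //.
apply/setP => X; rewrite finset.in_setI complements_line ?subvf // !inE.
by case: (A <= X)%VS; rewrite ?andbF.
Qed.
End DimensionCounts.


(** * Passage to cardinalities of classical sets, and complete graphs *)

Local Open Scope classical_set_scope.

(** Carries the counts of finite sets over to the equipotence in which degrees are stated. *)
Lemma card_finset_II (T : finType) (S : {set T}) : ([set` S] #= `I_#|S|)%card.
Proof.
rewrite (card_eqr card_II).
have -> : [set` S] = enum_val @` [set: 'I_#|S|].
  apply/seteqP; split=> [x /= xS|_ [i _ <-]]; last exact: enum_valP.
  by exists (enum_rank_in xS x); rewrite // enum_rankK_in.
by apply: inj_card_eq => i j _ _; apply: enum_val_inj.
Qed.

(** Any bijection of the vertices will do, since adjacency on both sides is just distinctness. *)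
Lemma graph_iso_complete (T : Type) (G : sgraph T) n :
  (vertices G #= `I_n)%card ->
  (forall x y, vertices G x -> vertices G y -> x <> y -> adj G x y) ->
  (0 < n)%N -> graph_iso G (complete_graph n).
Proof.
(* Positivity gives the ordinal type the successor form that [inord] requires. *)
case: n => // n cardG complG _.
move: cardG => /card_set_bijP[f bij_f].
have bij_inord : set_bij `I_n.+1 [set: 'I_n.+1] (@inord n) by [].
exists (@inord n \o f); have bij_g := set_bij_comp bij_f bij_inord.
split=> // x y Gx Gy; split=> [Gxy /= exy | nxy].
  have [_ inj_g _] := bij_g.
  by case: (@adj_irrefl _ G x); rewrite {2}(inj_g x y) ?inE.
by apply: complG => // exy; apply: nxy; rewrite exy.
Qed.

(** * The comaximal graph of a three-dimensional abelian Lie algebra *)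

Section AbelianDim3.
Variables (F : finFieldType) (L : lieAlgType F).
Hypotheses (hdim : \dim {:L} = 3%N) (hab : lie_abelian L).
Implicit Types A B X U : {vspace L}.

Lemma abelian_lie_subalgebra U : lie_subalgebra U.
Proof. by move=> x y _ _; rewrite hab mem0v. Qed.

(** [A + B] is itself one of the subalgebras being intersected, and all the others contain it. *)
Lemma abelian_lie_generatedU A B :
  lie_generated ([set` A] `|` [set` B]) = [set` (A + B)%VS].
Proof.
apply/seteqP; split=> [x | x /memv_addP[a aA [b bB ->]] U [_ ABU]].
  apply; split; first exact: abelian_lie_subalgebra.
  by move=> y [] yAB; [apply: (subvP (addvSl A B)) | apply: (subvP (addvSr A B))].
by apply: memvD; apply: ABU; [left | right].
Qed.

Lemma lie_linesE A : lie_lines L A <-> \dim A = 1%N.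
Proof. by split=> [[]|] //; split=> //; apply: abelian_lie_subalgebra. Qed.

Lemma lie_planesE A : lie_planes L A <-> \dim A = 2%N.
Proof. by split=> [[]|] //; split=> //; apply: abelian_lie_subalgebra. Qed.

Lemma comax_verticesE A : comax_vertices A <-> \dim A = 1%N \/ \dim A = 2%N.
Proof.
have eq0 : (A == 0%VS) = (\dim A == 0%N) by rewrite dimv_eq0.
have eqf : (A == fullv) = (\dim A == 3%N).
  apply/eqP/eqP => [->//|dimA]; apply/eqP.
  by rewrite eqEdim subvf hdim dimA.
have := dimvS (subvf A); rewrite hdim => leA.
split=> [[_ /eqP + /eqP]|dimA]; first by rewrite eq0 eqf; lia.
split; first exact: abelian_lie_subalgebra.
  by apply/eqP; rewrite eq0; lia.
by apply/eqP; rewrite eqf; lia.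
Qed.

Lemma comax_adjE A B : comax_adj A B <->
  [/\ comax_vertices A, comax_vertices B & (A + B)%VS = fullv].
Proof.
split=> [[VA VB _]|[VA VB AB]].
  rewrite abelian_lie_generatedU => AB; split=> //.
  by apply/vspaceP => x; rewrite memvf; have : [set: L] x by []; rewrite -AB.
split=> //.
  (* If [A = B], then [A = A + B] would be the whole algebra, which is not a vertex. *)
  by move=> eAB; case: VA => _ _; apply; rewrite -AB -eAB addvv.
rewrite abelian_lie_generatedU AB.
by apply/seteqP; split=> // x _; apply: memvf.
Qed.

Lemma planes_adj A B : \dim A = 2%N -> \dim B = 2%N -> A <> B -> comax_adj A B.
Proof.
move=> dimA dimB neAB; apply/comax_adjE; split; try by apply/comax_verticesE; right.
(* A sum of dimension at most 2 would coincide with each of the planes [A] and [B]. *)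
apply/eqP; rewrite eqEdim subvf hdim /= ltnNge; apply/negP => le2.
apply: neAB; transitivity (A + B)%VS; apply/eqP.
  by rewrite eqEdim addvSl dimA.
by rewrite eq_sym eqEdim addvSr dimB.
Qed.

Lemma lines_nadj A B : \dim A = 1%N -> \dim B = 1%N -> ~ comax_adj A B.
Proof.
move=> dimA dimB /comax_adjE[_ _ AB]; have := dimv_sum_cap A B.
by rewrite AB hdim dimA dimB.
Qed.

Lemma line_plane_adj A B : \dim A = 1%N -> \dim B = 2%N ->
  comax_adj A B <-> ~ (A <= B)%VS.
Proof.
move=> dimA dimB; have VA : comax_vertices A by apply/comax_verticesE; left.
have VB : comax_vertices B by apply/comax_verticesE; right.
have := complements_line B dimA (subvf A).
rewrite inE subvf dimA dimB hdim !andbT addvC /= => e.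
split=> [/comax_adjE[_ _ AB] | /negP AB].
  by apply/negP; rewrite -e AB.
by apply/comax_adjE; split=> //; apply/eqP; rewrite e.
Qed.

(** Lines are not adjacent to lines, so every neighbour is a plane and has the dimension of a
    complement. *)
Lemma neighbours_line A : \dim A = 1%N ->
  neighbours (comaximal_graph L) A = [set` complements fullv A].
Proof.
move=> dimA; apply/seteqP; split=> X /=.
  move=> AX; have /comax_adjE[_ /comax_verticesE[] dimX e] := AX.
    by case: (lines_nadj dimA dimX).
  by rewrite inE addvC e eqxx dimA dimX hdim.
rewrite complements_line ?subvf // hdim => /and3P[_ /eqP[dimX] /negP AX].
exact/line_plane_adj.
Qed.

(** The neighbours of dimension 2 are all the other planes; those of dimension 1 are the
    complementary lines. *)
Lemma neighbours_plane B : \dim B = 2%N ->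
  neighbours (comaximal_graph L) B =
  [set` (subspaces 2 fullv :\ B) :|: complements fullv B].
Proof.
move=> dimB; apply/seteqP; split=> X /=.
  move=> BX; have /comax_adjE[_ /comax_verticesE[] dimX e] := BX.
    by rewrite !inE [X in X || _]andbC addvC e eqxx dimX dimB hdim subvf.
  rewrite !inE subvf dimX eqxx !andbT; apply/orP; left.
  by apply/eqP => eXB; case: BX => _ _ /(_ (esym eXB)).
rewrite !inE => /orP[/and3P[/eqP neXB _ /eqP dimX]|/andP[/eqP e dimX]].
  by apply: planes_adj => // /esym.
apply/comax_adjE; rewrite addvC; split=> //; apply/comax_verticesE.
  by right.
by left; move: dimX; rewrite dimB hdim => /eqP; lia.
Qed.

Lemma degree_line A : \dim A = 1%N ->
  has_degree (comaximal_graph L) A (#|F| ^ 2)%N.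
Proof.
move=> dimA; rewrite /has_degree neighbours_line //.
have := card_finset_II (complements fullv A).
by rewrite card_complements ?subvf // hdim dimA muln1.
Qed.

Lemma degree_plane B : \dim B = 2%N ->
  has_degree (comaximal_graph L) B (2 * #|F| ^ 2 + #|F|)%N.
Proof.
move=> dimB; rewrite /has_degree neighbours_plane //.
have := card_finset_II ((subspaces 2 fullv :\ B) :|: complements fullv B).
rewrite cardsU card_complements ?subvf // hdim dimB mul1n.
(* The two families are disjoint: a complement of a plane has dimension 1, not 2. *)
rewrite (_ : _ :&: _ = finset.set0) ?cards0 ?subn0; last first.
  apply/setP => X; rewrite !inE; apply/negP => /andP[/and3P[_ _ /eqP ->]].
  by rewrite dimB hdim andbF.
(* Discarding [B] itself removes the 1 from [q ^ 2 + q + 1]; the complementary lines contribute the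
   second [q ^ 2]. *)
have := cardsD1 B (subspaces 2 {:L}); rewrite card_planes // inE subvf dimB eqxx.
rewrite addnC => /addnI <-.
by rewrite addnAC addnn mul2n.
Qed.

Lemma vertices_comaximal :
  vertices (comaximal_graph L) = lie_lines L `|` lie_planes L.
Proof.
by apply/seteqP; split=> X /=; rewrite /setU /= lie_linesE lie_planesE;
  apply comax_verticesE.
Qed.

Lemma planes_induced_complete :
  graph_iso (induced_subgraph (comaximal_graph L) (lie_planes L))
    (complete_graph (#|F| ^ 2 + #|F| + 1)%N).
Proof.
have sV : vertices (comaximal_graph L) `&` lie_planes L =
          [set` subspaces 2 {:L}].
  apply/seteqP; split=> X /=; rewrite inE subvf.
    by move=> [_ /lie_planesE ->].
  move=> /eqP dimX; split; last exact/lie_planesE.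
  by apply/comax_verticesE => //; right.
apply: graph_iso_complete; last by rewrite addn1.
  by rewrite -(card_planes hdim) [vertices _]sV; apply: card_finset_II.
move=> X Y [_ PX] [_ PY] neXY; split=> //.
by apply: planes_adj => //; apply/lie_planesE.
Qed.

End AbelianDim3.

Theorem proposition4p2 (F : finFieldType) (q : nat) (hq : #|F| = q)
    (L : lieAlgType F) (hdim : \dim {:L} = 3%N) (hab : lie_abelian L) :
  vertices (comaximal_graph L) = lie_lines L `|` lie_planes L /\
  lie_lines L `&` lie_planes L = set0 /\
  ((forall A B : {vspace L}, lie_planes L A -> lie_planes L B -> A <> B ->
      adj (comaximal_graph L) A B) /\
   graph_iso (induced_subgraph (comaximal_graph L) (lie_planes L))
     (complete_graph (q ^ 2 + q + 1)%N)) /\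
  ((forall A B : {vspace L}, lie_lines L A -> lie_lines L B ->
      ~ adj (comaximal_graph L) A B) /\
   independent (comaximal_graph L) (lie_lines L)) /\
  (forall A B : {vspace L}, lie_lines L A -> lie_planes L B ->
     (adj (comaximal_graph L) A B <-> ~ (A <= B)%VS)) /\
  (forall B : {vspace L}, lie_planes L B ->
     has_degree (comaximal_graph L) B (2 * q ^ 2 + q)%N) /\
  (forall A : {vspace L}, lie_lines L A ->
     has_degree (comaximal_graph L) A (q ^ 2)%N).
Proof.
have LE := lie_linesE hab; have PE := lie_planesE hab; subst q.
have nadj (A B : {vspace L}) : lie_lines L A -> lie_lines L B ->
    ~ adj (comaximal_graph L) A B.
  by move=> /LE dimA /LE dimB; apply: lines_nadj.
have VLP := vertices_comaximal hdim hab.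
split=> //; split.
  by apply/seteqP; split=> // X [[_ dimX] [_]]; rewrite dimX.
split.
  split; last exact: planes_induced_complete.
  by move=> A B /PE dimA /PE dimB; apply: planes_adj.
split; first by split=> //; split=> //; rewrite VLP; left.
split; first by move=> A B /LE dimA /PE dimB; apply: line_plane_adj.
split=> [B /PE|A /LE]; [exact: degree_plane | exact: degree_line].
Qed.
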